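(* Let $k=2m-1\ge 1$ and $\mathfrak{g}_k=\mathfrak{p}^A\frac{k+2|k}{2k+2}$ (a Frobenius type-A seaweed). The spectrum of $\mathfrak{g}_k$ is $\{-2,-1^2,0^3,1^3,2^2,3\}$ if $k=1$; $\{-3,-2^4,-1^8,0^{11},1^{11},2^8,3^4,4\}$ if $k=3$; $\{-4,-3^4,-2^{10},-1^{17},0^{22},1^{22},2^{17},3^{10},4^4,5\}$ if $k=5$; $\{-5,-4^4,-3^{10},-2^{19},-1^{28},0^{34},1^{34},2^{28},3^{19},4^{10},5^4,6\}$ if $k=7$; and for $k>7$ it is $$\{-m-1,-m^4,(-m+1)^{10},(-m+2)^{19},-1^{6k-14},0^{6k-8},1^{6k-8},2^{6k-14},(m-1)^{19},m^{10},(m+1)^4,m+2\}\cup\bigcup_{i=1}^{m-4}\{(-m+i+2)^{12i+18},(m-i-1)^{12i+18}\}.$$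
   Context: Type-A seaweeds: for compositions $\underline a=(a_1,\dots,a_m)$ and $\underline b=(b_1,\dots,b_t)$ of $n$, let $e_1,\dots,e_n$ be a basis of $V=\mathbb{C}^n$, $V_i=\mathrm{span}\{e_1,\dots,e_{a_1+\dots+a_i}\}$ and $W_j=\mathrm{span}\{e_{b_1+\dots+b_j+1},\dots,e_n\}$. The type-A seaweed $\mathfrak{p}^A\frac{a_1|\cdots|a_m}{b_1|\cdots|b_t}$ is the subalgebra of $\mathfrak{sl}(n)$ of matrices preserving both flags $0\subset V_1\subset\dots\subset V_m=V$ and $V=W_0\supset W_1\supset\dots\supset W_t=0$. A Lie algebra $\mathfrak{g}$ is Frobenius if there is $F\in\mathfrak{g}^*$ with $(x,y)\mapsto F([x,y])$ nondegenerate; then there is a unique $\widehat F\in\mathfrak{g}$ with $F([\widehat F,x])=F(x)$ for all $x$, and the spectrum of $\mathfrak{g}$ is the multiset of eigenvalues of $\mathrm{ad}\,\widehat F$ on $\mathfrak{g}$ (independent of the choice of Frobenius $F$). Notation: $\{x^k\}$ denotes $x$ with multiplicity $k$, and $\cup$ denotes multiset union (multiplicities add). *)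

(* Defs.v *)
From HB Require Import structures.
From mathcomp Require Import all_boot all_order all_algebra.

Set Implicit Arguments.
Unset Strict Implicit.
Unset Printing Implicit Defensive.

Import GRing.Theory.
Local Open Scope ring_scope.

(* Matrices act on column vectors; e_1, ..., e_n are the columns
   delta_mx 0 0, ..., delta_mx (n-1) 0. *)

Section Stabilizer.
Variables (K : fieldType) (n : nat).
Implicit Types (U : {vspace 'cV[K]_n}) (X Y : 'M[K]_n).

Definition preserves X U : Prop := forall u, u \in U -> X *m u \in U.

Definition stabilizer U : {vspace 'M[K]_n} :=
  (\bigcap_(u <- vbasis U) (linfun (mulmxr u : 'M[K]_n -> 'cV[K]_n) @^-1: U))%VS.

Lemma mem_stabilizer U X : X \in stabilizer U <-> preserves X U.
Proof.
have memE : X \in stabilizer U = all (fun u => X *m u \in U) (vbasis U).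
  rewrite /stabilizer; elim: (val (vbasis U)) => [|u s IHs] /=.
    by rewrite big_nil memvf.
  by rewrite big_cons memv_cap IHs -memv_preim lfunE.
rewrite memE; split=> [/allP XU u uU|XU]; last first.
  by apply/allP=> u ub; apply: XU; apply: vbasis_mem.
rewrite (coord_vbasis uU) mulmx_sumr; apply: memv_suml => i _.
by rewrite -scalemxAr memvZ // XU // mem_nth // size_tuple.
Qed.

Definition trace0 : {vspace 'M[K]_n} := lker (linfun (@mxtrace K n : _ -> K^o)).

Lemma mem_trace0 X : (X \in trace0) = (\tr X == 0).
Proof. by rewrite memv_ker lfunE. Qed.

End Stabilizer.

Section Seaweed.
Variables (K : fieldType) (n : nat).

Definition flagV (a : seq nat) (i : nat) : {vspace 'cV[K]_n} :=
  <<[seq (delta_mx l 0)%R | l : 'I_n <- enum 'I_n & (l < sumn (take i a))%N]>>%VS.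

Definition flagW (b : seq nat) (j : nat) : {vspace 'cV[K]_n} :=
  <<[seq (delta_mx l 0)%R | l : 'I_n <- enum 'I_n & (sumn (take j b) <= l)%N]>>%VS.

(* a and b are meant to be compositions of n. *)
Definition seaweedA (a b : seq nat) : {vspace 'M[K]_n} :=
  (trace0 K n :&: (\bigcap_(i < (size a).+1) stabilizer (flagV a i))
              :&: (\bigcap_(j < (size b).+1) stabilizer (flagW b j)))%VS.

Lemma mem_seaweedA a b X :
  X \in seaweedA a b <->
  [/\ \tr X = 0,
      forall i, (i <= size a)%N -> preserves X (flagV a i)
    & forall j, (j <= size b)%N -> preserves X (flagW b j)].
Proof.
rewrite /seaweedA !memv_cap mem_trace0; split.
  case/andP=> /andP[/eqP trX /subv_bigcapP XV] /subv_bigcapP XW.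
  split=> // [i|j]; rewrite -ltnS => lt.
    exact/mem_stabilizer/(XV (Ordinal lt)).
  exact/mem_stabilizer/(XW (Ordinal lt)).
case=> -> XV XW; rewrite eqxx /=; apply/andP; split; apply/subv_bigcapP.
  by move=> i _; apply/mem_stabilizer/XV; rewrite -ltnS.
by move=> j _; apply/mem_stabilizer/XW; rewrite -ltnS.
Qed.

End Seaweed.

Section MatrixLieAlgebra.
Variables (K : fieldType) (n : nat).
Implicit Types (X Y : 'M[K]_n) (g : {vspace 'M[K]_n}).

Definition lie_mx X Y : 'M[K]_n := X *m Y - Y *m X.

Definition lie_closed g : Prop :=
  forall X Y, X \in g -> Y \in g -> lie_mx X Y \in g.

Lemma seaweedA_lie_closed a b : lie_closed (seaweedA K n a b).
Proof.
move=> X Y /mem_seaweedA[trX XV XW] /mem_seaweedA[trY YV YW].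
have pres U : preserves X U -> preserves Y U -> preserves (lie_mx X Y) U.
  move=> XU YU u uU; rewrite /lie_mx mulmxBl -!mulmxA.
  by rewrite memvB // ?XU ?YU // ?XU ?YU.
apply/mem_seaweedA; split.
- by rewrite /lie_mx raddfB /= mxtrace_mulC subrr.
- by move=> i lei; apply: pres; [apply: XV | apply: YV].
- by move=> j lej; apply: pres; [apply: XW | apply: YW].
Qed.

(* The bracket of g, on the subtype of its elements. The projection vsproj g
   is the identity on brackets when g is a Lie subalgebra, see lie_subE. *)
Definition lie_sub g (x y : subvs_of g) : subvs_of g :=
  vsproj g (lie_mx (vsval x) (vsval y)).

Lemma lie_subE g : lie_closed g ->
  forall x y : subvs_of g, vsval (lie_sub x y) = lie_mx (vsval x) (vsval y).
Proof. by move=> gL x y; rewrite vsprojK // gL // subvsP. Qed.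

Fact lie_sub_linear g (x : subvs_of g) : linear (lie_sub x).
Proof.
move=> c y z; rewrite /lie_sub -linearP; congr (vsproj g _).
rewrite /lie_mx [vsval (_ + _)]linearP mulmxDl mulmxDr -scalemxAl -scalemxAr.
by rewrite scalerBr opprD addrACA.
Qed.
HB.instance Definition _ g x :=
  GRing.isSemilinear.Build K (subvs_of g) (subvs_of g) *:%R (@lie_sub g x)
    (GRing.semilinear_linear (lie_sub_linear x)).

Definition ad g (x : subvs_of g) : 'End(subvs_of g) := linfun (lie_sub x).

Lemma adE g (x y : subvs_of g) : ad x y = lie_sub x y.
Proof. by rewrite lfunE. Qed.

(* The form (x, y) |-> F [x, y] is skew-symmetric, so that a trivial left
   radical is nondegeneracy. *)
Definition frobenius_functional g (F : 'Hom(subvs_of g, K^o)) : Prop :=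
  forall x, (forall y, F (lie_sub x y) = 0) -> x = 0.

Definition frobenius g : Prop :=
  exists F : 'Hom(subvs_of g, K^o), frobenius_functional F.

Definition principal_element g (F : 'Hom(subvs_of g, K^o)) (Fh : subvs_of g) :
  Prop := forall x, F (lie_sub Fh x) = F x.

Lemma principal_element_exists_unique g (F : 'Hom(subvs_of g, K^o)) :
  frobenius_functional F -> exists! Fh, principal_element F Fh.
Proof.
move=> Fnd; pose B (x : subvs_of g) := (F \o ad x)%VF.
have BE x y : B x y = F (lie_sub x y) by rewrite comp_lfunE adE.
have B_lin : linear B.
  move=> c x y; apply/lfunP => z; rewrite add_lfunE scale_lfunE !BE -linearP.
  congr (F _); rewrite /lie_sub -linearP; congr (vsproj g _).
  rewrite /lie_mx [vsval (_ + _)]linearP mulmxDl mulmxDr -scalemxAl -scalemxAr.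
  by rewrite scalerBr opprD addrACA.
pose B_linM := GRing.isSemilinear.Build _ _ _ _ B
  (GRing.semilinear_linear B_lin).
pose psi := linfun (HB.pack_for {linear _ -> _} B B_linM).
have psiE x : psi x = B x by rewrite lfunE.
have psi_inj : lker psi == 0%VS.
  rewrite -subv0; apply/subvP => x; rewrite memv_ker memv0 psiE => /eqP Bx0.
  by apply/eqP/Fnd => y; rewrite -BE Bx0 lfunE.
have psi_full : limg psi = fullv.
  apply/eqP; rewrite eqEdim subvf limg_dim_eq ?(eqP psi_inj) ?capv0 //.
  by rewrite !dimvf /dim /= muln1.
have /memv_imgP[Fh _ FhE] : F \in limg psi by rewrite psi_full memvf.
exists Fh; split=> [x|Fh' Fh'E]; first by rewrite -BE -psiE -FhE.
apply/(lker0P psi_inj); rewrite -FhE psiE.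
by apply/lfunP => x; rewrite BE Fh'E.
Qed.

End MatrixLieAlgebra.

Section Spectrum.
Variable K : fieldType.

(* Algebraic multiplicity of z as an eigenvalue of f; the characteristic
   polynomial does not depend on the basis. *)
Definition eigen_mult (L : vectType K) (f : 'End(L)) (z : K) : nat :=
  mup z (char_poly (passmx.mxof (vbasis {:L}) (vbasis {:L}) f)).

(* For a Frobenius g: the spectrum of g is the sequence s regarded as a
   multiset, whichever Frobenius functional is used to compute it. By
   principal_element_exists_unique, this is not vacuous. *)
Definition has_spectrum n (g : {vspace 'M[K]_n}) (s : seq K) : Prop :=
  forall (F : 'Hom(subvs_of g, K^o)) (Fh : subvs_of g),
    frobenius_functional F -> principal_element F Fh ->
    forall z, eigen_mult (ad Fh) z = count_mem z s.

End Spectrum.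

(* Main.v *)
From HB Require Import structures.
Require Import Defs.
From mathcomp Require Import all_boot all_order all_algebra.
From mathcomp Require Import reals.
From mathcomp Require Import complex.
From mathcomp Require Import ring zify.

Set Implicit Arguments.
Unset Strict Implicit.
Unset Printing Implicit Defensive.

Import GRing.Theory Num.Theory passmx.
Local Open Scope ring_scope.

(* The spectrum does not depend on the Frobenius functional: along the line
   F_t = F_0 + t (F_1 - F_0) the principal element x_t is a rational function
   of t. If F_1 - F_0 = F_t [y_t, -], then differentiating F_t [x_t, -] = F_t
   gives x_t' = [x_t, y_t], so that ad x_t moves by commutators and its
   characteristic polynomial is constant in t (characteristic 0).

   It remains to find one Frobenius functional with a known principal element.
   For the parabolic with blocks k + 2 and k, take the sum of the coordinates
   along the arcs of a tree on the 2k + 2 indices. Its principal element is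
   diagonal, given up to sign and a scalar by the height function of the tree,
   so that the spectrum consists of the height differences of the pairs of
   indices in the parabolic. An element of the radical of the form restricts
   to an endomorphism of the Kronecker pencil formed by two shifts
   K^(k+2) -> K^k, and comparing entries shows that it is scalar. The heights
   on each diagonal block fill two intervals, so multiplicities are sums of
   interval overlaps. *)

(** * Derivatives of determinants *)

Lemma deriv_prod (R : comNzRingType) (I : eqType) (r : seq I)
    (f : I -> {poly R}) : uniq r ->
  (\prod_(i <- r) f i)^`() =
    \sum_(i <- r) (f i)^`() * \prod_(j <- r | j != i) f j.
Proof.
elim: r => [|x r IHr] /=; first by rewrite !big_nil -[1]/(1%:P) derivC.
case/andP=> xr ur; rewrite !big_cons derivM IHr // eqxx /=; congr (_ + _).
  congr (_ * _); rewrite big_seq [RHS]big_seq_cond; apply: eq_bigl => j.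
  by case: (boolP (j \in r)) => //= jr; rewrite eq_sym (memPnC xr).
rewrite mulr_sumr; apply: eq_big_seq => i ir.
by rewrite big_cons (memPnC xr _ ir) mulrCA.
Qed.

(** Jacobi's formula: the derivative is the sum over [i] of the determinants with row [i]
    differentiated, each expanded along that row. *)
Lemma deriv_det (R : comNzRingType) n (X : 'M[{poly R}]_n) :
  (\det X)^`() = \tr (\adj X *m map_mx (@deriv R) X).
Proof.
pose Xd i : 'M[{poly R}]_n :=
  \matrix_(a, b) if a == i then (X a b)^`() else X a b.
have detXd : (\det X)^`() = \sum_i \det (Xd i).
  rewrite /determinant raddf_sum /= exchange_big /=; apply: eq_bigr => s _.
  rewrite -mulr_sumr mulr_sign; under [in RHS]eq_bigr => i _.
    rewrite (bigD1 i) //= mxE eqxx.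
    under eq_bigr => j ji do rewrite mxE (negPf ji).
    over.
  by rewrite -deriv_prod ?index_enum_uniq // mulr_sign; case: ifP; rewrite ?derivN.
rewrite detXd /mxtrace; under eq_bigr => i _ do rewrite (expand_det_row _ i).
rewrite exchange_big /=; apply: eq_bigr => j _; rewrite mxE.
apply: eq_bigr => i _; rewrite !mxE eqxx mulrC; congr (_ * _).
rewrite /cofactor; congr (_ * \det _); apply/matrixP=> a b.
by rewrite !mxE eq_sym (negPf (neq_lift _ _)).
Qed.

(* Compares lowest-degree coefficients. *)
Lemma log_deriv_eq0 (K : fieldType) N (d q : {poly K}) :
  [pchar K] =i pred0 -> d.[0] != 0 -> q.[0] = 0 ->
  d * q^`() = d^`() * q *+ N -> q = 0.
Proof.
move=> ch0 d0 q0 dq; apply/polyP=> i; rewrite coef0.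
elim/ltn_ind: i => [[|i] IHi]; first by rewrite -horner_coef0.
have := congr1 (fun p : {poly K} => p`_i) dq.
rewrite /= coefMn mulrC !coefM big_ord_recr /= subnn coef_deriv.
rewrite big1 ?add0r; last first.
  by move=> j _; rewrite coef_deriv IHi ?mul0rn ?mul0r // ltnS.
rewrite big1 ?mul0rn; last first.
  by move=> j _; rewrite IHi ?mulr0 // ltnS leq_subr.
move/eqP; rewrite -horner_coef0 mulf_eq0 (negPf d0) orbF.
rewrite -mulr_natr mulf_eq0.
by rewrite ((pcharf0P K).1 ch0) orbF => /eqP.
Qed.

(** [f] and [d ^+ N] have the same logarithmic derivative, so [f - a *: d ^+ N] satisfies the same
    linear equation and vanishes at 0. *)
Lemma log_deriv_const (K : fieldType) N (d f : {poly K}) (a : K) :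
  [pchar K] =i pred0 -> d * f^`() = d^`() * f *+ N -> d.[0] != 0 ->
  f.[0] = a * d.[0] ^+ N -> f = a *: d ^+ N.
Proof.
move=> ch0 df d0 f0; apply/eqP; rewrite -subr_eq0; apply/eqP.
apply: (@log_deriv_eq0 _ N d) => //.
  by rewrite !hornerE f0 subrr.
rewrite derivB mulrBr df derivZ deriv_exp mulrBr mulrnBl; congr (_ - _).
rewrite -!scalerAr scalerMnr; congr (_ *: _).
by case: N {df f0} => [|N]; rewrite ?mulr0n ?mulr0 // mulrnAr mulrCA -exprS.
Qed.

(** * Lie brackets and functionals in coordinates *)

Section AdjointMatrix.
Variables (R : comNzRingType) (N : nat) (T : 'I_N -> 'M[R]_N).

(* The bracket [x, y] is y *m admx x: row vectors, as in passmx.mxof. *)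
Definition admx (x : 'rV[R]_N) : 'M[R]_N := \sum_i x 0 i *: T i.

(** The Jacobi identity in the form ad [x, y] = [ad x, ad y]; the factors are reversed because the
    matrices act on row vectors. *)
Definition jacobi_mx : Prop := forall x y : 'rV[R]_N,
  admx (y *m admx x) = admx y *m admx x - admx x *m admx y.

Fact admx_linear : linear admx.
Proof.
move=> c x y; rewrite /admx scaler_sumr -big_split; apply: eq_bigr => i _ /=.
by rewrite !mxE scalerDl scalerA.
Qed.
HB.instance Definition _ := GRing.isSemilinear.Build R _ _ _ admx
  (GRing.semilinear_linear admx_linear).

Lemma admx_delta i : admx (delta_mx 0 i) = T i.
Proof.
rewrite /admx (bigD1 i) //= mxE !eqxx scale1r big1 ?addr0 // => j ji.
by rewrite mxE (negPf ji) andbF scale0r.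
Qed.

Lemma jacobi_mxP :
  (forall i j, admx (row j (T i)) = T j *m T i - T i *m T j) -> jacobi_mx.
Proof.
move=> TT x y; have [A defA] : {A | A = admx x} by exists (admx x).
rewrite -defA [y in LHS]row_sum_delta [admx y]/admx.
rewrite !mulmx_suml mulmx_sumr raddf_sum -sumrB; apply: eq_bigr => j _.
rewrite -!scalemxAl -scalemxAr -scalerBr /= linearZ /=; congr (_ *: _).
rewrite -rowE; have -> : row j A = \sum_i x 0 i *: row j (T i).
  by rewrite defA /admx raddf_sum; apply: eq_bigr => i _; rewrite /= linearZ.
rewrite raddf_sum {}defA [admx x]/admx mulmx_sumr mulmx_suml -sumrB.
apply: eq_bigr => i _; rewrite -scalemxAl -scalemxAr -scalerBr -TT /=.
by rewrite linearZ.
Qed.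

End AdjointMatrix.

Section BaseChange.
Variables (R : comNzRingType) (N : nat) (T : 'I_N -> 'M[R]_N).

(** Structure constants as constant polynomials: the algebra extended to R[t], where t is the
    parameter of the line of functionals. *)
Let TP i : 'M[{poly R}]_N := map_mx polyC (T i).

Lemma admx_polyC (x : 'rV[R]_N) : admx TP (map_mx polyC x) = map_mx polyC (admx T x).
Proof.
rewrite /admx raddf_sum; apply: eq_bigr => i _ /=.
by rewrite mxE map_mxZ.
Qed.

Lemma jacobi_mx_polyC : jacobi_mx T -> jacobi_mx TP.
Proof.
move=> J; apply: jacobi_mxP => i j.
rewrite /TP -map_row admx_polyC -!map_mxM -raddfB; congr map_mx.
by have := J (delta_mx 0 i) (delta_mx 0 j); rewrite !admx_delta -rowE.
Qed.

Lemma horner_admx (x : 'rV[{poly R}]_N) t :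
  map_mx (horner_eval t) (admx TP x) = admx T (map_mx (horner_eval t) x).
Proof.
rewrite /admx raddf_sum; apply: eq_bigr => i _ /=; rewrite map_mxZ mxE.
congr (_ *: _); apply/matrixP=> a b.
by rewrite /TP !mxE /= /horner_eval hornerC.
Qed.

Lemma deriv_admx (x : 'rV[{poly R}]_N) :
  map_mx (@deriv R) (admx TP x) = admx TP (map_mx (@deriv R) x).
Proof.
apply/matrixP => a b; rewrite mxE !summxE raddf_sum; apply: eq_bigr => i _ /=.
by rewrite !mxE derivM derivC mulr0 addr0.
Qed.

End BaseChange.

Section Gram.
Variables (R : comNzRingType) (N : nat) (T : 'I_N -> 'M[R]_N).

Lemma admxD (x y : 'rV[R]_N) : admx T (x + y) = admx T x + admx T y.
Proof. exact: linearD. Qed.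

Lemma admxB (x y : 'rV[R]_N) : admx T (x - y) = admx T x - admx T y.
Proof. exact: linearB. Qed.

Lemma admxZ c (x : 'rV[R]_N) : admx T (c *: x) = c *: admx T x.
Proof. exact: linearZ. Qed.

(* A functional F is given by the column phi of its values on the basis, so that
   F [x, y] = y *m admx T x *m phi. *)
Definition gram (phi : 'cV[R]_N) : 'M[R]_N :=
  \matrix_(i, j) (T i *m phi) j 0.

Lemma mul_gram phi (x : 'rV[R]_N) : x *m gram phi = (admx T x *m phi)^T.
Proof.
apply/rowP=> j; rewrite [LHS]mxE [RHS]mxE /admx mulmx_suml summxE.
by apply: eq_bigr => i _; rewrite -scalemxAl [RHS]mxE [gram _ _ _]mxE.
Qed.

(** Cramer's rule: the adjugate represents [psi] through the form up to the factor
    [\det (gram phi)], so solutions over K[t] stay polynomial. *)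
Lemma admx_adj_gram phi (psi : 'cV[R]_N) :
  admx T (psi^T *m \adj (gram phi)) *m phi = \det (gram phi) *: psi.
Proof.
apply: trmx_inj; rewrite -mul_gram -mulmxA mul_adj_mx.
by rewrite mul_mx_scalar linearZ.
Qed.

End Gram.

Lemma admx_gram_inj (R : idomainType) N (T : 'I_N -> 'M[R]_N) phi x :
  \det (gram T phi) != 0 -> admx T x *m phi = 0 -> x = 0.
Proof.
move=> d0 x0; have := congr1 (mulmx^~ (\adj (gram T phi))) (mul_gram T phi x).
rewrite /= x0 trmx0 mul0mx -mulmxA mul_mx_adj mul_mx_scalar.
by move/eqP; rewrite scalemx_eq0 (negPf d0) => /eqP.
Qed.

Lemma det_gram_neq0 (R : fieldType) N (T : 'I_N -> 'M[R]_N) phi :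
  (forall x, admx T x *m phi = 0 -> x = 0) -> \det (gram T phi) != 0.
Proof.
move=> nd; apply/negP=> /det0P[v v0 vG].
by case/eqP: v0; apply: nd; rewrite -[LHS]trmxK -mul_gram vG trmx0.
Qed.

(** * Motion of the principal element with the functional *)

Section Flow.
Variables (K : fieldType) (N : nat) (T : 'I_N -> 'M[{poly K}]_N).
Local Notation D := (map_mx (@deriv K)).
Hypothesis jacT : jacobi_mx T.
Hypothesis derivT : forall x, D (admx T x) = admx T (D x).
Variables (phi : 'cV[{poly K}]_N) (d : {poly K}) (V Y : 'rV[{poly K}]_N).
Hypothesis phi_inj : forall x, admx T x *m phi = 0 -> x = 0.
Hypothesis adV : admx T V *m phi = d *: phi.
Hypothesis adY : admx T Y *m phi = d *: D phi.

Lemma deriv_mulmx m n p (A : 'M[{poly K}]_(m, n)) (C : 'M_(n, p)) :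
  D (A *m C) = D A *m C + A *m D C.
Proof.
apply/matrixP => i j; rewrite !mxE raddf_sum -big_split; apply: eq_bigr => l _ /=.
by rewrite derivM !mxE.
Qed.

Lemma deriv_scalemx m n (c : {poly K}) (A : 'M[{poly K}]_(m, n)) :
  D (c *: A) = c^`() *: A + c *: D A.
Proof. by apply/matrixP => i j; rewrite !mxE derivM. Qed.

(* The principal element V / d moves in the direction of [V / d, Y / d]: this
   is the derivative of F_t [V / d, x] = F_t x, with F_t' = F_t [Y / d, -]. *)
Lemma deriv_principal : d *: D V = d^`() *: V - V *m admx T Y.
Proof.
(* By nondegeneracy both sides may be compared after bracketing and applying [phi]. *)
apply/eqP; rewrite -subr_eq0; apply/eqP/phi_inj.
have DadV := congr1 D adV; rewrite deriv_mulmx deriv_scalemx derivT in DadV.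
rewrite opprB addrA admxB admxD !admxZ jacT !(mulmxBl, mulmxDl) -!scalemxAl.
rewrite -!mulmxA adV adY -!scalemxAr adY.
have -> : admx T (D V) *m phi = d^`() *: phi + d *: D phi - admx T V *m D phi.
  by rewrite -DadV addrK.
by apply/matrixP => i j; rewrite !mxE; ring.
Qed.

Lemma deriv_det_pencil z (X := z%:P *: d%:M - admx T V) :
  d * (\det X)^`() = d^`() * \det X *+ N.
Proof.
have dDX : d *: D X = d^`() *: X + (admx T V *m admx T Y - admx T Y *m admx T V).
  have -> : D X = z%:P *: (d^`())%:M - admx T (D V).
    rewrite -derivT; apply/matrixP=> i j; rewrite !mxE derivB derivM derivC.
    rewrite mul0r add0r; congr (_ * _ - _).
    by case: (i == j); rewrite ?mulr1n ?mulr0n ?derivC.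
  rewrite scalerBr -admxZ deriv_principal admxB admxZ jacT.
  rewrite opprB addrCA [RHS]addrC scalerBr; congr (_ + (_ - _)).
  by rewrite !scale_scalar_mx; congr (_%:M); ring.
rewrite deriv_det -[d * _]mxtraceZ scalemxAr dDX mulmxDr mxtraceD -scalemxAr.
rewrite mul_adj_mx mxtraceZ mxtrace_scalar mulrnAr.
(* [\adj X] commutes with [X], hence with [admx T V]; cyclicity of the trace then cancels the two
   products. *)
suff -> : \tr (\adj X *m (admx T V *m admx T Y - admx T Y *m admx T V)) = 0.
  by rewrite addr0.
have MX : admx T V = z%:P *: d%:M - X by rewrite /X opprB addrC subrK.
have cMX : admx T V *m \adj X = \adj X *m admx T V.
  rewrite MX mulmxBl mulmxBr mul_mx_adj mul_adj_mx -scalemxAl -scalemxAr.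
  by rewrite mul_scalar_mx mul_mx_scalar.
by rewrite mulmxBr mulmxA -cMX -mulmxA raddfB /= mxtrace_mulC -mulmxA subrr.
Qed.

End Flow.

Lemma eq_poly_horner (K : fieldType) (p q : {poly K}) :
  [pchar K] =i pred0 -> (forall z, p.[z] = q.[z]) -> p = q.
Proof.
move=> ch0 pq; apply/eqP; rewrite -subr_eq0; set r := p - q.
apply: contraT => r0.
(* In characteristic 0 the numbers 0, ..., [size r - 1] are distinct, which is one root more than
   the degree of [r] allows. *)
have := @max_poly_roots _ r [seq n%:R | n <- iota 0 (size r)] r0.
rewrite size_map size_iota ltnn => -> //.
  by apply/allP=> _ /mapP[n _ ->]; rewrite /root hornerD hornerN pq subrr.
rewrite map_inj_in_uniq ?iota_uniq // => a b _ _ /eqP.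
wlog: a b / (a <= b)%N => [H|ab].
  by case/orP: (leq_total a b) => ab; [exact: H | rewrite eq_sym => /H->].
rewrite eq_sym -subr_eq0 -natrB // ((pcharf0P K).1 ch0) subn_eq0 => ba.
by apply/anti_leq; rewrite ab.
Qed.

Lemma det_pencil_horner (K : fieldType) N (A : 'M[K]_N) (d : {poly K}) z t :
  \det (map_mx (horner_eval t) (z%:P *: d%:M) - d.[t] *: A) =
    (char_poly A).[z] * d.[t] ^+ N.
Proof.
rewrite /char_poly /char_poly_mx -/(horner_eval z _) -[in RHS]det_map_mx mulrC.
rewrite -detZ; congr (\det _); apply/matrixP=> i j.
rewrite !mxE /= !/horner_eval hornerM hornerD hornerN !hornerMn !hornerC hornerX.
by rewrite mulrBr !mulrnAr mulrC.
Qed.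

(** * Constancy of the characteristic polynomial along a line *)

Section SpectralInvariance.
Variables (K : fieldType) (N : nat) (T : 'I_N -> 'M[K]_N).
Hypothesis ch0 : [pchar K] =i pred0.
Hypothesis jacT : jacobi_mx T.
Variables (phi0 phi1 : 'cV[K]_N).

Lemma char_poly_principal (x0 x1 : 'rV[K]_N) :
  (forall x, admx T x *m phi0 = 0 -> x = 0) ->
  (forall x, admx T x *m phi1 = 0 -> x = 0) ->
  admx T x0 *m phi0 = phi0 -> admx T x1 *m phi1 = phi1 ->
  char_poly (admx T x0) = char_poly (admx T x1).
Proof.
move=> nd0 nd1 px0 px1.
pose TP i : 'M[{poly K}]_N := map_mx polyC (T i).
pose phi : 'cV[{poly K}]_N :=
  map_mx polyC phi0 + 'X *: map_mx polyC (phi1 - phi0).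
pose d := \det (gram TP phi); pose V := phi^T *m \adj (gram TP phi).
have adV : admx TP V *m phi = d *: phi by apply: admx_adj_gram.
have adY := admx_adj_gram TP phi (map_mx (@deriv K) phi).
have phiE t : map_mx (horner_eval t) phi = phi0 + t *: (phi1 - phi0).
  by apply/matrixP => i j; rewrite !mxE /horner_eval !hornerE.
have dE t : d.[t] = \det (gram T (phi0 + t *: (phi1 - phi0))).
  rewrite -/(horner_eval t _) -det_map_mx -phiE; congr (\det _).
  apply/matrixP=> i j; rewrite [LHS]mxE [gram TP _ _ _]mxE [RHS]mxE ![(_ *m _) _ _]mxE.
  rewrite raddf_sum; apply: eq_bigr => l _ /=.
  by rewrite rmorphM /= [TP _ _ _]mxE [map_mx _ phi _ _]mxE /horner_eval hornerC.
(* The form may degenerate at other parameters. Nondegeneracy at 0 already makes [d] a nonzero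
   polynomial, so the form over K[t] has trivial radical. *)
have d00 : d.[0] != 0 by rewrite dE scale0r addr0 det_gram_neq0.
have d10 : d.[1] != 0 by rewrite dE scale1r subrKC det_gram_neq0.
have d0 : d != 0 by apply: contraNneq d00 => ->; rewrite horner0.
(* Where the form is nondegenerate the principal element is unique, so [V] specializes at [t] to
   [d.[t] *: x]. *)
have detE t psi x z : psi = phi0 + t *: (phi1 - phi0) ->
    (forall x, admx T x *m psi = 0 -> x = 0) -> admx T x *m psi = psi ->
  (\det (z%:P *: d%:M - admx TP V)).[t] = (char_poly (admx T x)).[z] * d.[t] ^+ N.
  move=> psiE nd px.
  have Vt : map_mx (horner_eval t) V = d.[t] *: x.
    apply/eqP; rewrite -subr_eq0; apply/eqP/nd.
    rewrite admxB admxZ mulmxBl -scalemxAl px -horner_admx.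
    have := congr1 (map_mx (horner_eval t)) adV.
    by rewrite map_mxM map_mxZ phiE -psiE => ->; rewrite subrr.
  rewrite -/(horner_eval t _) -det_map_mx map_mxB horner_admx Vt admxZ.
  exact: det_pencil_horner.
apply: (eq_poly_horner ch0) => z.
have pencil := deriv_det_pencil (jacobi_mx_polyC jacT) (@deriv_admx _ _ T)
  (fun x => @admx_gram_inj _ _ TP phi x d0) adV adY z.
have detE0 := detE 0 phi0 x0 z _ nd0 px0.
(* The determinant is a constant times [d ^+ N]; the constant is read off at t = 0, and evaluation
   at t = 1 compares it with [x1]. *)
have := log_deriv_const ch0 pencil d00 (detE0 _).
rewrite scale0r addr0 => /(_ erefl)/(congr1 (horner^~ 1)).
rewrite (detE 1 phi1 x1) ?scale1r ?subrKC // !hornerE.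
by move/(mulIf (expf_neq0 _ d10)).
Qed.

End SpectralInvariance.

(** * Independence of the Frobenius functional *)

Section LieInvariance.
Variables (K : fieldType) (n : nat) (g : {vspace 'M[K]_n}).
Hypothesis ch0 : [pchar K] =i pred0.
Hypothesis gL : lie_closed g.
Local Notation L := (subvs_of g).
Local Notation b := (vbasis {:L}).
Local Notation mx f := (mxof b b f).

Fact ad_linear : linear (@ad K n g).
Proof.
move=> c x y; apply/lfunP => z; rewrite add_lfunE scale_lfunE !adE.
apply: val_inj; rewrite [RHS]linearP /= !lie_subE // /lie_mx.
rewrite [vsval (_ + _)]linearP mulmxDl mulmxDr -scalemxAl -scalemxAr.
by rewrite scalerBr opprD addrACA.
Qed.
HB.instance Definition _ := GRing.isSemilinear.Build K _ _ _ (@ad K n g)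
  (GRing.semilinear_linear ad_linear).

Lemma ad_lie_sub (x y : L) :
  ad (lie_sub x y) = (ad x \o ad y)%VF - (ad y \o ad x)%VF.
Proof.
apply/lfunP => z; rewrite add_lfunE opp_lfunE !comp_lfunE !adE.
apply: val_inj; rewrite [RHS]linearB /= !lie_subE // /lie_mx.
move: (vsval x) (vsval y) (vsval z) => X Y Z.
rewrite !(mulmxBl, mulmxBr) !mulmxA.
move: (X *m Y *m Z) (Y *m X *m Z) (Z *m X *m Y) (Z *m Y *m X) => A B C D.
move: (X *m Z *m Y) (Y *m Z *m X) => E G.
by apply/matrixP=> i j; rewrite !mxE; ring.
Qed.

Let T (i : 'I_(\dim {:L})) := mx (ad b`_i).

Let admxE (x : L) : admx T (rVof b x) = mx (ad x).
Proof.
have bb : basis_of {:L} b by apply: vbasisP.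
rewrite -[x in RHS](rVofK bb) /vecof !linear_sum /=.
by apply: eq_bigr => i _; rewrite !linearZ.
Qed.

Let jacT : jacobi_mx T.
Proof.
have bb : basis_of {:L} b by apply: vbasisP.
apply: jacobi_mxP => i j; rewrite rowE mul_mxof vecof_delta.
rewrite admxE adE ad_lie_sub linearB /=.
by rewrite !(mxof_comp _ _ bb).
Qed.

Let col_of (F : 'Hom(L, K^o)) : 'cV[K]_(\dim {:L}) := \col_i F b`_i.

Let mul_col_of (F : 'Hom(L, K^o)) (v : 'rV_(\dim {:L})) :
  v *m col_of F = (F (vecof b v))%:M.
Proof.
apply/matrixP=> i j; rewrite !ord1 !mxE mulr1n /vecof linear_sum.
by apply: eq_bigr => l _; rewrite !mxE linearZ.
Qed.

Lemma char_poly_ad_principal (F0 F1 : 'Hom(L, K^o)) (x0 x1 : L) :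
  frobenius_functional F0 -> principal_element F0 x0 ->
  frobenius_functional F1 -> principal_element F1 x1 ->
  char_poly (mx (ad x0)) = char_poly (mx (ad x1)).
Proof.
have bb : basis_of {:L} b by apply: vbasisP.
have adF (F : 'Hom(L, K^o)) x (v : 'rV_(\dim {:L})) :
    v *m (mx (ad x) *m col_of F) = (F (lie_sub x (vecof b v)))%:M.
  by rewrite mulmxA mul_col_of mul_mxof rVofK // adE.
have nd F : frobenius_functional F ->
    forall v, admx T v *m col_of F = 0 -> v = 0.
  move=> ndF v; rewrite -[v](vecofK bb) admxE => v0.
  rewrite (ndF (vecof b v)) ?linear0 // => y.
  have := adF F (vecof b v) (rVof b y).
  rewrite v0 mulmx0 rVofK // => /matrixP/(_ 0 0).
  by rewrite !mxE mulr1n.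
have pr F x : principal_element F x ->
    admx T (rVof b x) *m col_of F = col_of F.
  move=> prF; apply/row_matrixP => i; rewrite !rowE admxE adF prF.
  by rewrite mul_col_of.
move=> nd0 pr0 nd1 pr1; rewrite -!admxE.
by apply: (char_poly_principal ch0 jacT (nd _ nd0) (nd _ nd1)); apply: pr.
Qed.

End LieInvariance.

(** * Characteristic polynomial from an eigenbasis *)

Section Diagonalizable.
Variables (K : fieldType) (L : vectType K).

Lemma char_poly_conj n (A D P : 'M[K]_n) :
  P \in unitmx -> A *m P = P *m D -> char_poly A = char_poly D.
Proof.
move=> uP AP; have uPX : \det (map_mx polyC P) != 0.
  by rewrite det_map_mx polyC_eq0 -unitfE.
apply: (mulIf uPX); rewrite -det_mulmx mulrC -det_mulmx; congr (\det _).
rewrite /char_poly_mx mulmxBl mulmxBr -!map_mxM AP.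
by rewrite mul_scalar_mx mul_mx_scalar.
Qed.

Lemma char_poly_eigenbasis (I : Type) (s : seq I) (f : 'End(L))
    (e : I -> L) (c : I -> K) :
  basis_of {:L} [seq e i | i <- s] ->
  (forall i, f (e i) = c i *: e i) ->
  char_poly (mxof (vbasis {:L}) (vbasis {:L}) f) =
    \prod_(y <- [seq c i | i <- s]) ('X - y%:P).
Proof.
move=> eb fe; set C := map c _; have bb := vbasisP {:L}; set b := vbasis _ in bb *.
have se : size [seq e i | i <- s] == \dim {:L}.
  by case/andP: eb => /eqP <-; rewrite eq_sym.
pose E := Tuple se; have Eb : basis_of {:L} E by [].
pose P := mxof b E \1.
have uP : P \in unitmx.
  suff: P *m mxof E b \1 = 1%:M by case/mulmx1_unit.
  by rewrite -(mxof_comp _ _ Eb) // comp_lfun1l mxof1 // (basis_free bb).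
have -> : char_poly (mxof b b f) = char_poly (mxof E E f).
  apply: (char_poly_conj uP); rewrite -(mxof_comp _ _ bb) //.
  by rewrite -(mxof_comp _ _ Eb) comp_lfun1l comp_lfun1r.
have sC : size C = \dim {:L} by rewrite -(eqP se) !size_map.
have fE (i : 'I_(\dim {:L})) : f E`_i = C`_i *: E`_i.
  have ii : (i < size s)%N by rewrite -(size_map e) (eqP se).
  have i0 : I by case: (s) ii => [|i0].
  by rewrite /E /C /= !(nth_map i0) // fe.
have mE i j : mxof E E f i j = C`_i *+ (i == j).
  rewrite -[LHS]mulr1 /mxof mxE /= vecof_delta fE linearZ /=.
  by rewrite rVofE // !mxE eqxx mulr1 /= eq_sym mulr_natr.
rewrite char_poly_trig; last first.
  by apply/is_trig_mxP => i j ij; rewrite mE -val_eqE /= (ltn_eqF ij).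
rewrite (big_nth 0) sC big_mkord; apply: eq_bigr => i _.
by rewrite mE eqxx.
Qed.

End Diagonalizable.

(** * The parabolic subalgebra and the meander tree *)

Section CoordinateFlags.
Variables (K : fieldType) (n : nat).

(** The common shape of [flagV] and [flagW]. *)
Definition coord_space (P : pred 'I_n) : {vspace 'cV[K]_n} :=
  <<[seq (delta_mx l 0)%R | l : 'I_n <- enum 'I_n & P l]>>%VS.

Lemma mem_coord_space (P : pred 'I_n) u :
  u \in coord_space P <-> (forall i, ~~ P i -> u i 0 = 0).
Proof.
split=> [uP i Pi|u0].
  rewrite (@coord_span _ _ _ (in_tuple _) _ uP) summxE big1 // => j _.
  rewrite mxE /=; set e := (_ `_ j).
  have : e \in [seq delta_mx l 0 | l : 'I_n <- enum 'I_n & P l] by apply: mem_nth.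
  case/mapP=> l; rewrite mem_filter => /andP[Pl _] ->.
  by rewrite mxE; case: eqP Pl Pi => [<- ->|]; rewrite ?mulr0.
rewrite (matrix_sum_delta u); apply: memv_suml => i _.
rewrite big_ord1; have [Pi|/u0->] := boolP (P i); last by rewrite scale0r mem0v.
apply/memvZ/memv_span/mapP; exists i => //.
by rewrite mem_filter Pi mem_enum.
Qed.

Lemma preserves_coord_space (P : pred 'I_n) (X : 'M[K]_n) :
  preserves X (coord_space P) <-> (forall i j, P j -> ~~ P i -> X i j = 0).
Proof.
split=> [XP i j Pj Pi|X0 u /mem_coord_space u0].
  have /XP/mem_coord_space/(_ i Pi) : delta_mx j 0 \in coord_space P.
    apply/mem_coord_space => l; rewrite mxE andbT; case: eqP => // ->.
    by rewrite Pj.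
  rewrite mxE (bigD1 j) //= mxE !eqxx mulr1 big1 ?addr0 // => l lj.
  by rewrite mxE (negPf lj) mulr0.
apply/mem_coord_space => i Pi; rewrite mxE big1 // => j _.
by have [Pj|/u0->] := boolP (P j); rewrite ?mulr0 // (X0 _ _ Pj Pi) mul0r.
Qed.

Lemma mem_seaweedA_parabolic a b X : n = (a + b)%N ->
  X \in seaweedA K n [:: a; b] [:: n] <->
  \tr X = 0 /\ (forall i j : 'I_n, (a <= i)%N -> (j < a)%N -> X i j = 0).
Proof.
move=> nab; split=> [/mem_seaweedA[trX XV _]|[trX X0]].
  split=> // i j ai ja.
  apply: ((preserves_coord_space (fun l : 'I_n => l < a)%N X).1 _ i j ja).
    by have := XV 1%N isT; rewrite /flagV /= addn0.
  by rewrite -leqNgt.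
(* The other flag members are zero or the whole space; only V_1 imposes a condition. *)
apply/mem_seaweedA; split=> //= [[|[|[|]]]|[|[|]]] // _;
  apply/preserves_coord_space => i j /=; rewrite ?addn0 //.
- by rewrite -leqNgt => ja ai; apply: X0.
- by rewrite -nab !ltn_ord.
- by rewrite leqNgt ltn_ord.
Qed.

End CoordinateFlags.

(** The expansion gives spanning; applying [h i] to a vanishing combination isolates its coefficient
    at [i], which gives freeness. *)
Lemma basis_of_dual (K : fieldType) (L : vectType K) (I : eqType) (s : seq I)
    (e : I -> L) (h : I -> {linear L -> K^o}) :
  uniq s -> (forall x, x = \sum_(i <- s) h i x *: e i) ->
  {in s &, forall i j, h i (e j) = (i == j)%:R} ->
  basis_of {:L} [seq e i | i <- s].
Proof.
move=> us spans dual; apply/andP; split.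
  rewrite eqEsubv subvf /=; apply/subvP=> x _; rewrite (spans x).
  rewrite big_seq; apply: memv_suml => i si; apply/memvZ/memv_span.
  exact: map_f.
apply/(@freeP _ _ _ (in_tuple [seq e i | i <- s])) => c c0 i.
have lt_s (j : 'I_(size [seq e i | i <- s])) : (j < size s)%N.
  by rewrite -(size_map e).
have i0 : I by move: (leq_ltn_trans (leq0n _) (lt_s i)); case: (s) => [|i0].
have := congr1 (h (nth i0 s i)) c0; rewrite linear_sum linear0 => <-.
rewrite (bigD1 i) //= big1 ?addr0 => [|j ji]; rewrite linearZ /= (nth_map i0) //.
  by rewrite dual ?mem_nth // eqxx [_ *: _]mulr1.
rewrite dual ?mem_nth // nth_uniq // eq_sym -[(_ == _)%N]/(j == i) (negPf ji).
by rewrite [_ *: _]mulr0.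
Qed.

Section Meander.
Variables (k : nat).

(* The 2k + 1 arcs (mpred v, v), v != 1, form a tree rooted at 1 on the 2k + 2
   vertices; the value mpred 1 = 1 - 2 = 0 is junk. *)
Definition mpred (v : nat) : nat :=
  if v == 0%N then 1%N else if (v < k + 2)%N then (v - 2)%N else (v - k)%N.

(** Depth in the tree: steps of -2 lead odd indices to the root 1 and even indices to 0, which is
    one further arc away from it. *)
Definition height0 (v : nat) : nat := (v./2 + ~~ odd v)%N.
Definition height (v : nat) : nat :=
  if (v < k + 2)%N then height0 v else (height0 (v - k)).+1.

Lemma height_mpred v : v != 1%N -> (v < 2 * k + 2)%N ->
  height v = (height (mpred v)).+1.
Proof.
rewrite /height /mpred /height0 => v1 vn.
case: eqP => [->|/eqP v0]; first by rewrite !ifT //; lia.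
have [vk|vk] := ltnP v (k + 2)%N; first by rewrite ifT; lia.
by rewrite ifT; lia.
Qed.

Lemma ltn_mpred v : (0 < k)%N -> (v < 2 * k + 2)%N -> (mpred v < 2 * k + 2)%N.
Proof. by rewrite /mpred; case: ifP => [|_]; [|case: ifP]; lia. Qed.

(** The children of [u], sorted by type of arc. The cases are disjoint, so the indicator is a sum
    that distributes over matrix products. *)
Lemma mpredE (v u : nat) : (v < 2 * k + 2)%N -> (u < 2 * k + 2)%N ->
  ((v != 1) && (mpred v == u) =
    ((v == 0) && (u == 1)) + ((v == u + 2) && (u < k))
    + ((v == u + k) && (1 < u < k + 2)) :> nat)%N.
Proof.
rewrite /mpred => vn un; case: ifP => v0; [|case: ifP => vk].
- lia.
- lia.
- lia.
Qed.

(** With [f] the entries of X and Phi the matrix of the tree, the last hypothesis equates the (v, u)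
    entries of Phi X and X Phi for (u, v) in the parabolic. The equations carry entries along arcs,
    until they reach a known zero or the diagonal. *)
Lemma meander_commutant (K : fieldType) (f : nat -> nat -> K) :
  odd k ->
  (forall i j, (k + 2 <= i < 2 * k + 2)%N -> (j < k + 2)%N -> f i j = 0) ->
  (forall u v, (u < 2 * k + 2)%N -> (v < 2 * k + 2)%N ->
     (u < k + 2)%N || (k + 2 <= v)%N ->
     f (mpred v) u *+ (v != 1%N) =
       f v 0%N *+ (u == 1%N) + f v (u + 2)%N *+ (u < k)%N
       + f v (u + k)%N *+ (1 < u < k + 2)%N) ->
  exists p, forall i j, (i < 2 * k + 2)%N -> (j < 2 * k + 2)%N ->
    f i j = p *+ (i == j).
Proof.
move=> ko f0 fE.
have mp2 i : mpred (i + (k + 2)) = i.+2.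
  by rewrite /mpred !ifF; lia.
have mp1 i : (i < k)%N -> mpred i.+2 = i by rewrite /mpred /= => ik; rewrite ifT; lia.
(* [fE] with the predecessor and the side conditions as parameters, so that each instance comes with
   their truth values. *)
have eqn u v w (b0 b1 b2 b3 : bool) : (u < 2 * k + 2)%N -> (v < 2 * k + 2)%N ->
    (u < k + 2)%N || (k + 2 <= v)%N -> mpred v = w -> (v != 1%N) = b0 ->
    (u == 1%N) = b1 -> (u < k)%N = b2 -> (1 < u < k + 2)%N = b3 ->
    f w u *+ b0 = f v 0%N *+ b1 + f v (u + 2)%N *+ b2 + f v (u + k)%N *+ b3.
  by move=> un vn uv <- <- <- <- <-; exact: fE.
(* Arcs of length [k] identify the second diagonal block with the rows and columns from 2 on of the
   first. *)
have PS i j : (i < k)%N -> (j < k)%N -> f (i + (k + 2))%N (j + (k + 2))%N = f i.+2 j.+2.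
  move=> ik jk.
  have := eqn j.+2 (i + (k + 2))%N i.+2 true false (j.+2 < k)%N true ltac:(lia)
    ltac:(lia) ltac:(lia) (mp2 i) ltac:(lia) ltac:(lia) erefl ltac:(lia).
  rewrite !mulr1n mulr0n add0r => ->.
  have -> : f (i + (k + 2))%N (j.+2 + 2)%N *+ (j.+2 < k)%N = 0.
    by case: ltnP => [jk'|_]; rewrite ?mulr0n // f0 ?mul0rn //; lia.
  by rewrite add0r; congr f; lia.
have PL i j : (i < k)%N -> (j < 2)%N -> f i.+2 j = 0.
  move=> ik jk.
  have := eqn j (i + (k + 2))%N i.+2 true (j == 1%N) (j < k)%N false ltac:(lia)
    ltac:(lia) ltac:(lia) (mp2 i) ltac:(lia) erefl erefl ltac:(lia).
  rewrite mulr1n mulr0n addr0 => ->; rewrite (f0 _ 0%N) ?mul0rn ?add0r; [|lia|lia].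
  by case: ltnP => [jk'|_]; rewrite ?mulr0n // f0 ?mul0rn //; lia.
have Q2 i j : (i < k)%N -> (j < k)%N -> f i.+2 (j + (k + 2))%N = 0.
  move=> ik jk.
  have := eqn (j + (k + 2))%N (i + (k + 2))%N i.+2 true false false false ltac:(lia)
    ltac:(lia) ltac:(lia) (mp2 i) ltac:(lia) ltac:(lia) ltac:(lia) ltac:(lia).
  by rewrite mulr1n !mulr0n !add0r.
(* Arcs of length 2 make the first block invariant under the diagonal shift by 2, with zeros where
   the column would leave the block. *)
have Pstep i j : (i < k)%N -> (j < k + 2)%N -> f i j = f i.+2 j.+2 *+ (j < k)%N.
  move=> ik jk.
  have := eqn j i.+2 i true (j == 1%N) (j < k)%N (1 < j)%N ltac:(lia)
    ltac:(lia) ltac:(lia) (mp1 i ik) ltac:(lia) erefl erefl ltac:(lia).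
  rewrite mulr1n => ->; rewrite (PL i 0%N ik) // mul0rn add0r addn2.
  case: (ltnP 1 j) => [j1|_]; last by rewrite mulr0n addr0.
  have -> : (j + k = (j - 2) + (k + 2))%N by lia.
  by rewrite Q2 ?mul0rn ?addr0 //; lia.
have Psh t i j : (i + t.*2 < k + 2)%N -> (j + t.*2 < k + 2)%N ->
    f (i + t.*2)%N (j + t.*2)%N = f i j.
  elim: t i j => [|t IHt] i j; first by rewrite !addn0.
  rewrite doubleS !addnS => it jt; rewrite -(IHt i j); [|lia|lia].
  have jk : (j + t.*2 < k)%N by lia.
  by rewrite (Pstep (i + t.*2)%N) ?jk //; lia.
have Pup i j : (i < k)%N -> (k <= j < k + 2)%N -> f i j = 0.
  move=> ik jk; rewrite Pstep; [|lia|lia].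
  by have -> : (j < k)%N = false by lia.
have Pfar i j : (i + 2 <= j)%N -> (j < k + 2)%N -> f i j = 0.
  (* This shift brings the column to [k] or [k + 1] and keeps the row below [k]. *)
  move=> ij jk; rewrite -(Psh ((k.+1 - j)./2)%N); [|lia|lia].
  by apply: Pup; lia.
have P10 : f 1%N 0%N = 0.
  have := eqn 0%N 0%N 1%N true false true false ltac:(lia)
    ltac:(lia) ltac:(lia) erefl ltac:(lia) erefl ltac:(lia) erefl.
  by rewrite !mulr1n !mulr0n add0r addr0 => ->; apply: Pfar; lia.
(* At the root 1 there is no arc to a predecessor, so the left side of the equation vanishes. *)
have P12 : f 1%N 2%N = 0.
  have := eqn 0%N 1%N (mpred 1) false false true false ltac:(lia)
    ltac:(lia) ltac:(lia) erefl ltac:(lia) erefl ltac:(lia) erefl.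
  by rewrite mulr1n !mulr0n add0r addr0 => <-.
have P01 : f 0%N 1%N = 0.
  (* As [k] is odd, the shift is by [k - 1] and leads to position (k - 1, k). *)
  rewrite -(Psh k./2); [|lia|lia]; apply: Pup; lia.
have P11 : f 1%N 1%N = f 0%N 0%N.
  have := eqn 1%N 0%N 1%N true true (1 < k)%N false ltac:(lia)
    ltac:(lia) ltac:(lia) erefl ltac:(lia) erefl erefl erefl.
  rewrite !mulr1n !mulr0n addr0 => ->.
  case: ltnP => k1; rewrite ?mulr0n ?addr0 //.
  by rewrite (Pfar 0%N (1 + 2)%N) ?mul0rn ?addr0 //; lia.
have P i j : (i < k + 2)%N -> (j < k + 2)%N -> f i j = f 0%N 0%N *+ (i == j).
  wlog ij2 : i j / (i < 2)%N || (j < 2)%N => [H ik jk|ik jk].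
    have [t [i' [j' [iE jE ij]]]] : exists t i' j',
        [/\ i = (i' + t.*2)%N, j = (j' + t.*2)%N & (i' < 2)%N || (j' < 2)%N].
      exists (minn i./2 j./2), (i - (minn i./2 j./2).*2)%N, (j - (minn i./2 j./2).*2)%N.
      by split; lia.
    rewrite iE jE Psh; [|lia|lia]; rewrite H //; [|lia|lia].
    by rewrite eqn_add2r.
  case: (ltnP i 2%N) => i2.
    have [ij|ij] := leqP (i + 2)%N j.
      by rewrite Pfar //; have -> : (i == j) = false by lia.
    have [/eqP ijE|] := boolP (i == j).
      by case: i i2 ijE {ij ij2 ik} => [|[|//]] _ <-.
    have : [|| (i == 0) && (j == 1), (i == 1) && (j == 0) | (i == 1) && (j == 2)]%N ||
      (i == j) by lia.
    by case/orP=> [/or3P[]/andP[/eqP-> /eqP->]|->].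
  have {}ij2 : (j < 2)%N by lia.
  have -> : (i == j) = false by lia.
  by rewrite -(subnKC i2) PL //; lia.
(* Rows from 2 on are [Q2]; rows 0 and 1 follow from the equations at v = 0 and v = 1. *)
have Q i j : (i < k + 2)%N -> (j < k)%N -> f i (j + (k + 2))%N = 0.
  have Pj i' : (i' < 2)%N -> (j < k)%N -> f i' (j.+2 + 2)%N *+ (j.+2 < k)%N = 0.
    by move=> i2 jk; case: ltnP => jk'; rewrite ?mulr0n // Pfar ?mul0rn //; lia.
  have -> : (j + (k + 2) = j.+2 + k)%N by lia.
  case: i => [|[|i]] ik jk.
  - have := eqn j.+2 0%N 1%N true false (j.+2 < k)%N true ltac:(lia)
      ltac:(lia) ltac:(lia) erefl ltac:(lia) ltac:(lia) erefl ltac:(lia).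
    rewrite Pj // (P 1%N) /=; [|lia|lia].
    by rewrite !mulr0n ?mul0rn mulr1n !add0r => <-.
  - have := eqn j.+2 1%N (mpred 1) false false (j.+2 < k)%N true ltac:(lia)
      ltac:(lia) ltac:(lia) erefl ltac:(lia) ltac:(lia) erefl ltac:(lia).
    by rewrite Pj // !mulr0n mulr1n !add0r.
  - have -> : (j.+2 + k = j + (k + 2))%N by lia.
    by apply: Q2; lia.
exists (f 0%N 0%N) => i j iN jN.
have [ik|ik] := ltnP i (k + 2)%N; have [jk|jk] := ltnP j (k + 2)%N.
- exact: P.
- have -> : (i == j) = false by lia.
  by rewrite -(subnK jk) Q //; lia.
- have -> : (i == j) = false by lia.
  by rewrite f0 //; lia.
rewrite -(subnK ik) -(subnK jk) PS; [|lia|lia].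
by rewrite P ?eqn_add2r //; lia.
Qed.

End Meander.

(** * The matrix of the tree *)

Section MeanderMatrix.
Variables (K : fieldType) (k : nat).

Definition meander_mx n : 'M[K]_n :=
  \matrix_(v, u) (((v : nat) != 1%N) && (mpred k v == u))%:R.

(** Positions of the whole parabolic: despite the name, the upper right block is included. *)
Definition levi_pos n : pred ('I_n * 'I_n) :=
  fun p => (p.1 < k + 2)%N || (k + 2 <= p.2)%N.

Lemma mxtrace_mul_delta n (Z : 'M[K]_n) u v : \tr (Z *m delta_mx u v) = Z v u.
Proof.
rewrite /mxtrace (bigD1 v) //= mxE (bigD1 u) //= mxE !eqxx mulr1 !big1 ?addr0 //.
  by move=> i iv; rewrite mxE big1 // => j _; rewrite mxE (negPf iv) andbF mulr0.
by move=> i iu; rewrite mxE (negPf iu) mulr0.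
Qed.

Lemma meander_mx_commutant n (X : 'M[K]_n) : n = (2 * k + 2)%N -> odd k ->
  (forall i j : 'I_n, (k + 2 <= i)%N -> (j < k + 2)%N -> X i j = 0) ->
  (forall u v : 'I_n, levi_pos (u, v) -> lie_mx (meander_mx n) X v u = 0) ->
  exists p, X = p%:M.
Proof.
(* Indexing entries by natural numbers lets indices be shifted freely; [inord] is faithful on
   indices in range. *)
case: n X => [|n] X; first by lia.
move=> nE ko X0 Z0; pose f a b := X (inord a) (inord b).
have fX (i j : 'I_n.+1) : X i j = f i j by rewrite /f !inord_val.
have pick (v : 'I_n.+1) (c : nat) (P : bool) : (P -> c < n.+1)%N ->
    \sum_(w < n.+1) X v w * ((w == c :> nat) && P)%:R = f v c *+ P.
  case: P => [/(_ isT) cn|_]; last first.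
    by rewrite big1 // => w _; rewrite andbF mulr0.
  rewrite (bigD1 (inord c)) //= inordK // eqxx mulr1 big1 ?addr0 => [|w].
    by rewrite /f inord_val.
  by rewrite -val_eqE /= inordK // => /negPf->; rewrite mulr0.
have [||p fp] := @meander_commutant k K f ko.
- by move=> i j /andP[ik iN] jk; apply: X0; rewrite inordK; lia.
- move=> u v un vn uv; have := Z0 (inord u) (inord v).
  rewrite /levi_pos /= !inordK ?nE // => /(_ uv)/eqP.
  rewrite !mxE subr_eq0 => /eqP ZE.
  have <- : \sum_j meander_mx n.+1 (inord v) j * X j (inord u) =
      f (mpred k v) u *+ (v != 1%N).
    have pn := @ltn_mpred k v (odd_gt0 ko) vn; rewrite -nE in pn.
    rewrite (bigD1 (inord (mpred k v))) //= mxE !inordK ?nE // -?nE //.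
    rewrite eqxx andbT -[RHS]mulr_natl big1 ?addr0 // => w.
    rewrite -val_eqE /= inordK // => /negPf wp.
    by rewrite mxE inordK ?nE // [mpred _ _ == _]eq_sym wp andbF mul0r.
  rewrite {}ZE.
  under eq_bigr => w _.
    have wn : (w < 2 * k + 2)%N by rewrite -nE.
    rewrite mxE [(inord u : 'I_n.+1) : nat]inordK ?nE // mpredE //.
    rewrite !natrD !mulrDr; over.
  rewrite !big_split /= !pick ?nE; try lia.
  by rewrite /f !inord_val; congr (X _ _ *+ _ + _ + _); apply: val_inj.
exists p; apply/matrixP=> i j; rewrite fX fp -?nE // mxE.
by rewrite -val_eqE.
Qed.

End MeanderMatrix.

Fact origin_subproof k : (0 < 2 * k + 2)%N. Proof. by rewrite addn2. Qed.
Definition origin k : 'I_(2 * k + 2) := Ordinal (origin_subproof k).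

(** Index set of a basis of the seaweed: one diagonal position is dropped on account of the trace
    condition. *)
Definition levi_pairs k : {set 'I_(2 * k + 2) * 'I_(2 * k + 2)} :=
  [set p | levi_pos k p & p != (origin k, origin k)].

(** * Frobenius functional, principal element and eigenbasis *)

Section ParabolicSpectrum.
Variables (K : fieldType) (k : nat).
Hypothesis ch0 : [pchar K] =i pred0.
Hypothesis ko : odd k.
Local Notation n := (2 * k + 2)%N.
Let g : {vspace 'M[K]_n} := seaweedA K n [:: (k + 2)%N; k] [:: n].
Local Notation L := (subvs_of g).
Local Notation Phi := (meander_mx K k n).

Let gP X : X \in g <->
  \tr X = 0 /\ (forall i j : 'I_n, (k + 2 <= i)%N -> (j < k + 2)%N -> X i j = 0).
Proof. by apply: mem_seaweedA_parabolic; lia. Qed.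

Let gL : lie_closed g. Proof. exact: seaweedA_lie_closed. Qed.

Let n_neq0 : n%:R != 0 :> K.
Proof. by rewrite ((pcharf0P K).1 ch0); lia. Qed.

(** The trace pairing with [Phi] sums the entries of [x] at the arcs (mpred v, v). *)
Let form (x : L) : K^o := \tr (Phi *m vsval x).

Fact form_linear : linear form.
Proof.
move=> c x y; rewrite /form [vsval _]linearP mulmxDr -scalemxAr mxtraceD mxtraceZ.
by [].
Qed.
HB.instance Definition _ := GRing.isSemilinear.Build K L K^o *:%R form
  (GRing.semilinear_linear form_linear).

Definition meander_form : 'Hom(L, K^o) := linfun form.

Lemma meander_formE x : meander_form x = \tr (Phi *m vsval x).
Proof. by rewrite lfunE. Qed.

(** Invariance of the trace form, which turns the radical into a condition on the commutator with
    [Phi]. *)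
Lemma meander_form_lie x y :
  meander_form (lie_sub x y) = \tr (lie_mx Phi (vsval x) *m vsval y).
Proof.
rewrite meander_formE lie_subE // /lie_mx mulmxBl mulmxBr !raddfB /= !mulmxA.
by congr (_ - _); rewrite mxtrace_mulC mulmxA.
Qed.

Lemma meander_form_frobenius : frobenius_functional meander_form.
Proof.
move=> x x0; have [trx lx] := (gP _).1 (subvsP x).
have [|u v uv|p xp] := meander_mx_commutant erefl ko (X := vsval x) => //.
  (* The scalar part makes [y] traceless and pairs to zero with a commutator, so [y] tests the entry
     (v, u). *)
  pose y : 'M[K]_n := delta_mx u v - ((u == v)%:R / n%:R)%:M.
  have yg : y \in g.
    apply/gP; split=> [|i j ik jk].
      rewrite raddfB /= mxtrace_scalar -[_ *+ n]mulr_natr divfK //.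
      by rewrite -[delta_mx u v]mul1mx mxtrace_mul_delta mxE eq_sym subrr.
    rewrite !mxE (_ : (i == j) = false) ?subr0; last first.
      by apply/eqP => ij; move: ij ik jk => ->; lia.
    case: eqP => // iu; case: eqP => // jv; subst; move: uv.
    by rewrite /levi_pos /= ltnNge ik leqNgt jk.
  have := x0 (vsproj g y); rewrite meander_form_lie vsprojK // mulmxBr raddfB /=.
  rewrite mxtrace_mul_delta mul_mx_scalar mxtraceZ /lie_mx raddfB /=.
  by rewrite mxtrace_mulC subrr mulr0 subr0.
apply: val_inj; rewrite /= xp; move: trx; rewrite xp mxtrace_scalar => /eqP.
rewrite -[_ *+ n]mulr_natr mulf_eq0 (negPf n_neq0) orbF => /eqP->.
by rewrite raddf0.
Qed.

Let ht (i : 'I_n) : K := (height k i)%:R.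
Let pc : K := (\sum_i ht i) / n%:R.

(** The mean height [pc] makes the trace zero; bracketing with this matrix scales the entry (i, j)
    by [ht j - ht i]. *)
Definition meander_principal : L := vsproj g (diag_mx (\row_i (pc - ht i))).

Lemma meander_principalE :
  vsval meander_principal = diag_mx (\row_i (pc - ht i)).
Proof.
rewrite vsprojK //; apply/gP; split=> [|i j ik jk].
  rewrite mxtrace_diag; under eq_bigr => i _ do rewrite mxE.
  by rewrite sumrB sumr_const card_ord -[pc *+ n]mulr_natr divfK ?subrr.
by rewrite !mxE (_ : (i == j) = false) //; apply/eqP=> ij; move: ij ik jk => ->; lia.
Qed.

(** Heights rise by one along each arc, so the commutator of [Phi] with the diagonal matrix is [Phi]
    itself. *)
Lemma meander_formP : principal_element meander_form meander_principal.
Proof.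
move=> x; rewrite meander_form_lie meander_formE; congr (\tr (_ *m _)).
rewrite meander_principalE /lie_mx mul_mx_diag mul_diag_mx.
apply/matrixP=> v u; rewrite !mxE mulrC -mulrBl.
case: (boolP (_ && _)) => [/andP[v1 /eqP vu]|]; last by rewrite mulr0.
by rewrite mulr1 /ht (height_mpred v1) // vu -natr1 -[RHS]/(1 : K); ring.
Qed.

Local Notation o := (origin k).
Local Notation levi_pairs := (levi_pairs k).

Let elt (p : 'I_n * 'I_n) : 'M[K]_n :=
  delta_mx p.1 p.2 - (p.1 == p.2)%:R *: delta_mx o o.

Let elt_g p : p \in levi_pairs -> elt p \in g.
Proof.
rewrite inE /levi_pos => /andP[lp _]; apply/gP; split=> [|i j ik jk].
  rewrite raddfB /= mxtraceZ -[delta_mx p.1 p.2]mul1mx -[delta_mx o o]mul1mx.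
  by rewrite !mxtrace_mul_delta !mxE eqxx eq_sym mulr1 subrr.
rewrite !mxE [i == o](_ : _ = false) ?mulr0 ?subr0.
  case: eqP => // ip; case: eqP => // jp; subst.
  by move: lp; rewrite ltnNge ik leqNgt jk.
by apply/eqP => io; move: ik; rewrite io /=; lia.
Qed.

Let entry (p : 'I_n * 'I_n) (x : L) : K^o := vsval x p.1 p.2.

Fact entry_linear p : linear (entry p).
Proof. by move=> c x y; rewrite /entry [vsval _]linearP !mxE. Qed.
HB.instance Definition _ p := GRing.isSemilinear.Build K L K^o *:%R (entry p)
  (GRing.semilinear_linear (entry_linear p)).

Let sum_levi (V : zmodType) (G : 'I_n * 'I_n -> V) :
  (forall p, ~~ levi_pos k p -> G p = 0) ->
  \sum_(p in levi_pairs) G p = \sum_p G p - G (o, o).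
Proof.
move=> G0; rewrite [in RHS](bigD1 (o, o)) //= addrAC subrr add0r.
rewrite big_mkcond [RHS]big_mkcond.
apply: eq_bigr => p _; rewrite inE; case: (boolP (levi_pos k p)) => //= /G0->.
by case: ifP.
Qed.

(** Since the trace is zero, the corrections at the origin add up to exactly the omitted entry
    X_oo. *)
Lemma levi_decomposition X : X \in g ->
  X = \sum_(p in levi_pairs) X p.1 p.2 *: elt p.
Proof.
case/gP=> trX lX.
have X0 (p : 'I_n * 'I_n) : ~~ levi_pos k p -> X p.1 p.2 = 0.
  by rewrite negb_or -!leqNgt -ltnNge => /andP[]; apply: lX.
under eq_bigr => p _ do rewrite /elt scalerBr scalerA.
rewrite sumrB -scaler_suml !sum_levi; last 2 first.
- by move=> p /X0->; rewrite mul0r.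
- by move=> p /X0->; rewrite scale0r.
rewrite [X in LHS]matrix_sum_delta pair_bigA .
suff -> : \sum_(p : 'I_n * 'I_n) X p.1 p.2 * (p.1 == p.2)%:R = 0.
  by rewrite /= ?eqxx mulr1 sub0r scaleNr opprK subrK.
rewrite -(pair_bigA _ (fun i j => X i j * (i == j)%:R)) -[RHS]trX /mxtrace /=.
apply: eq_bigr => i _; rewrite (bigD1 i) //= eqxx mulr1 big1 ?addr0 // => j ji.
by rewrite eq_sym (negPf ji) mulr0.
Qed.

Lemma levi_basis :
  basis_of {:L} [seq vsproj g (elt p) | p <- enum levi_pairs].
Proof.
apply: (basis_of_dual (h := fun p => HB.pack_for {linear L -> K^o} (entry p)));
  first exact: enum_uniq.
  move=> x; rewrite -[x in LHS]vsvalK {1}(levi_decomposition (subvsP x)).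
  by rewrite linear_sum big_enum /=; apply: eq_bigr => p _; rewrite linearZ.
move=> p q; rewrite !mem_enum => ps qs; rewrite /entry /= vsprojK ?elt_g //.
move: ps; rewrite inE => /andP[_ po]; rewrite !mxE -!xpair_eqE -!surjective_pairing.
by rewrite (negPf po) mulr0 subr0.
Qed.

Lemma seaweed_spectrum : has_spectrum g
  [seq (height k p.2)%:R - (height k p.1)%:R | p : 'I_n * 'I_n <- enum levi_pairs].
Proof.
move=> F Fh Fnd FhP z; rewrite /eigen_mult.
rewrite (char_poly_ad_principal ch0 gL Fnd FhP meander_form_frobenius meander_formP).
(* Extension by zero makes the eigenvector equation hold for all pairs, as [char_poly_eigenbasis]
   asks. *)
pose e p : L := if p \in levi_pairs then vsproj g (elt p) else 0.
have eb : basis_of {:L} [seq e p | p <- enum levi_pairs].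
  rewrite (_ : map e _ = [seq vsproj g (elt p) | p <- enum levi_pairs]) ?levi_basis //.
  by apply/eq_in_map => p; rewrite mem_enum /e => ->.
rewrite (char_poly_eigenbasis (c := fun p => ht p.2 - ht p.1) eb) ?mu_prod_XsubC //.
move=> p; rewrite /e adE; case: ifP => [pl|_]; last by rewrite linear0 scaler0.
have valZ (c : K) (w : L) : vsval (c *: w) = c *: vsval w by exact: linearZ.
apply: val_inj; rewrite [RHS]valZ [LHS](lie_subE gL) vsprojK ?elt_g //.
rewrite meander_principalE /lie_mx mul_mx_diag mul_diag_mx.
apply/matrixP => i j; rewrite !mxE.
case: (boolP ((i == p.1) && (j == p.2))) => [/andP[/eqP-> /eqP->]|_]; first by ring.
case: (eqVneq p.1 p.2) => [->|_]; last by rewrite !mul0r subrr !mulr0 mul0r subrr.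
by case: (boolP ((i == o) && (j == o))) => [/andP[/eqP-> /eqP->]|_];
  rewrite ?mulr0n ?mulr1n; ring.
Qed.

Lemma seaweed_frobenius : frobenius g.
Proof. by exists meander_form; apply: meander_form_frobenius. Qed.

End ParabolicSpectrum.

(** * Counting height differences *)

Lemma count_tally_seq (T : eqType) (x : T) (t : seq (T * nat)) :
  count_mem x (tally_seq t) = (\sum_(y <- t) (y.1 == x) * y.2)%N.
Proof.
rewrite /tally_seq count_flatten sumnE !big_map; apply: eq_bigr => y _.
exact: count_nseq.
Qed.

Lemma big_cat_seq (I J R : Type) (idx : R) (op : Monoid.law idx) (r : seq I)
    (f : I -> seq J) (F : J -> R) :
  \big[op/idx]_(x <- \big[cat/[::]]_(i <- r) f i) F x =
    \big[op/idx]_(i <- r) \big[op/idx]_(x <- f i) F x.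
Proof.
elim: r => [|i r IHr]; first by rewrite !big_nil.
by rewrite !big_cons big_cat IHr.
Qed.

Lemma big_nat_pick (R : Type) (idx : R) (op : Monoid.law idx) (a b : nat)
    (w : int) (G : nat -> R) :
  \big[op/idx]_(a <= i < b) (if i%:Z == w then G i else idx) =
    if a%:Z <= w < b%:Z then G `|w|%N else idx.
Proof.
have [ab|ba] := leqP a b; last by rewrite big_geq ?ifF //; lia.
elim: b ab => [|b IHb].
  by rewrite leqn0 => /eqP->; rewrite big_geq ?ifF //; lia.
rewrite leq_eqVlt => /orP[/eqP->|ab]; first by rewrite big_geq ?ifF //; lia.
rewrite big_nat_recr //= IHb //; case: eqP => [<-|bw].
  by rewrite ifF ?ifT ?Monoid.mul1m //; lia.
by rewrite Monoid.mulm1; congr (if _ then _ else _); lia.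
Qed.

Definition overlap (a b c d : nat) (z : int) : nat :=
  (\sum_(a <= x < b) \sum_(c <= y < d) (y%:Z - x%:Z == z)%R)%N.

(** Each [x] admits only [y = x + z], so the pairs correspond to the integers in the intersection of
    [a, b) and [c - z, d - z). *)
Lemma overlapE a b c d z : (overlap a b c d z)%:Z =
  Num.max 0 (Num.min b%:Z (d%:Z - z) - Num.max a%:Z (c%:Z - z)).
Proof.
have inner x : (\sum_(c <= y < d) (y%:Z - x%:Z == z)%R)%N =
    (c%:Z <= x%:Z + z < d%:Z)%R :> nat.
  transitivity (\sum_(c <= y < d) if (y%:Z == x%:Z + z)%R then 1 else 0)%N.
    by apply: eq_bigr => y _; have -> : (y%:Z - x%:Z == z) = (y%:Z == x%:Z + z) by lia.
  by rewrite big_nat_pick; case: ifP.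
rewrite /overlap; under eq_bigr do rewrite inner.
have [ab|ba] := leqP a b; last by rewrite big_geq; lia.
elim: b ab => [|b IHb]; first by rewrite leqn0 => /eqP->; rewrite big_geq; lia.
rewrite leq_eqVlt => /orP[/eqP->|ab]; first by rewrite big_geq; lia.
by rewrite big_nat_recr //= PoszD IHb //; lia.
Qed.

(** The even [l] from 2s to 2a have heights s + 1, ..., a + 1, and the odd ones between them s, ...,
    a - 1. *)
Lemma sum_height0 (s a : nat) (G : nat -> nat) : (s <= a)%N ->
  (\sum_(s.*2 <= l < a.*2.+1) G (height0 l) =
    \sum_(s.+1 <= e < a.+2) G e + \sum_(s <= e < a) G e)%N.
Proof.
elim: a => [|a IHa].
  by rewrite leqn0 => /eqP->; rewrite [X in (_ + X)%N]big_geq // !big_nat1 addn0.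
rewrite leq_eqVlt => /orP[/eqP->|sa].
  by rewrite [X in (_ + X)%N]big_geq // !big_nat1 addn0; congr G; rewrite /height0; lia.
have recr i j (F : nat -> nat) : (i <= j)%N ->
    (\sum_(i <= l < j.+1) F l = \sum_(i <= l < j) F l + F j)%N.
  by move=> ij; rewrite big_nat_recr.
rewrite doubleS (recr s.*2) ?(recr _ a.*2.+1) ?(recr _ a.+2) ?(recr _ a) ?IHa //;
  try lia.
have -> : height0 a.*2.+1 = a by rewrite /height0; lia.
have -> : height0 a.*2.+2 = a.+2 by rewrite /height0; lia.
by lia.
Qed.

Section PairCount.
Variables (m : nat).
Hypothesis m_gt0 : (0 < m)%N.
Local Notation k := (2 * m - 1)%N.
Local Notation n := (2 * k + 2)%N.

Lemma sum_height_sub (G : nat -> nat) : (\sum_(0 <= i < k + 2) G (height k i) =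
  \sum_(1 <= e < m + 2) G e + \sum_(0 <= e < m) G e)%N.
Proof.
rewrite (addn2 m) -(sum_height0 G (leq0n m)) (_ : (k + 2 = m.*2.+1)%N); last by lia.
rewrite !big_nat; apply: eq_bigr => i im; congr G; rewrite /height ifT //; lia.
Qed.

Lemma sum_height_quo (G : nat -> nat) : (\sum_(k + 2 <= i < n) G (height k i) =
  \sum_(3 <= e < m + 3) G e + \sum_(2 <= e < m + 1) G e)%N.
Proof.
(* Subtracting [k] moves the second block to 2, ..., 2m, the case s = 1, a = m of [sum_height0],
   with heights raised by one. *)
rewrite (_ : (k + 2 = 1.*2 + k)%N); last by lia.
rewrite (_ : n = (m.*2.+1 + k)%N); last by lia.
rewrite big_addn (_ : (m.*2.+1 + k - k = m.*2.+1)%N); last by lia.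
transitivity (\sum_(1.*2 <= l < m.*2.+1) G (height0 l).+1)%N.
  rewrite !big_nat; apply: eq_bigr => i im; congr G.
  by rewrite /height ifF ?addnK //; lia.
rewrite (sum_height0 (fun e => G e.+1) m_gt0) addn3 addn1.
by congr (_ + _)%N; rewrite [RHS]big_add1.
Qed.

Definition height_diff (p : 'I_n * 'I_n) : int :=
  (height k p.2)%:Z - (height k p.1)%:Z.

(** The parabolic consists of three blocks, and the heights of each index block fill two intervals,
    hence four overlaps per block. The term [z == 0] restores the omitted pair of origins. *)
Lemma count_levi_pairs (z : int) :
  (count_mem z [seq height_diff p | p <- enum (levi_pairs k)] + (z == 0) =
    overlap 1 (m + 2) 1 (m + 2) z + overlap 1 (m + 2) 0 m z
    + overlap 0 m 1 (m + 2) z + overlap 0 m 0 m z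
    + (overlap 1 (m + 2) 3 (m + 3) z + overlap 1 (m + 2) 2 (m + 1) z
       + overlap 0 m 3 (m + 3) z + overlap 0 m 2 (m + 1) z)
    + (overlap 3 (m + 3) 3 (m + 3) z + overlap 3 (m + 3) 2 (m + 1) z
       + overlap 2 (m + 1) 3 (m + 3) z + overlap 2 (m + 1) 2 (m + 1) z))%N.
Proof.
pose N (e e' : nat) : nat := (e'%:Z - e%:Z == z).
pose D i j := N (height k i) (height k j).
have -> : (count_mem z [seq height_diff p | p <- enum (levi_pairs k)] + (z == 0) =
    \sum_(p : 'I_n * 'I_n | levi_pos k p) D p.1 p.2)%N.
  rewrite count_map -sum1_count big_enum_cond /= big_mkcondr addnC.
  rewrite [RHS](bigD1 (origin k, origin k)) /=; last by rewrite /levi_pos /= addn2.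
  congr (_ + _)%N.
    by rewrite /D /N /= subrr eq_sym.
  apply: eq_big => p; first by rewrite inE.
  by rewrite /D /N /height_diff; case: eqP.
have -> : (\sum_(p : 'I_n * 'I_n | levi_pos k p) D p.1 p.2 =
    \sum_(0 <= i < k + 2) \sum_(0 <= j < k + 2) D i j
    + \sum_(0 <= i < k + 2) \sum_(k + 2 <= j < n) D i j
    + \sum_(k + 2 <= i < n) \sum_(k + 2 <= j < n) D i j)%N.
  pose W i j : nat := if (i < k + 2)%N || (k + 2 <= j)%N then D i j else 0%N.
  transitivity (\sum_(0 <= i < n) \sum_(0 <= j < n) W i j)%N.
    rewrite big_mkcond big_mkord.
    under [RHS]eq_bigr do rewrite big_mkord.
    by rewrite pair_bigA.
  rewrite (@big_cat_nat _ _ _ (k + 2)) /=; [|lia|lia]; congr (_ + _)%N.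
    rewrite -big_split /= !big_nat; apply: eq_bigr => i ik.
    rewrite -(@big_cat_nat _ _ _ (k + 2)) /=; [|lia|lia].
    by apply: eq_bigr => j _; rewrite /W ifT //; lia.
  rewrite !big_nat; apply: eq_bigr => i ik.
  rewrite (@big_cat_nat _ _ _ (k + 2)) /=; [|lia|lia].
  rewrite !big_nat big1 => [|j jk]; last by rewrite /W ifF //; lia.
  by apply: eq_bigr => j jk; rewrite /W ifT //; lia.
under eq_bigr => i _ do rewrite (sum_height_sub (N (height k i))).
rewrite (sum_height_sub (fun e =>
  \sum_(1 <= e' < m + 2) N e e' + \sum_(0 <= e' < m) N e e')%N).
under [X in (_ + X + _)%N]eq_bigr => i _ do rewrite (sum_height_quo (N (height k i))).
rewrite (sum_height_sub (fun e =>
  \sum_(3 <= e' < m + 3) N e e' + \sum_(2 <= e' < m + 1) N e e')%N).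
under [X in (_ + X)%N]eq_bigr => i _ do rewrite (sum_height_quo (N (height k i))).
rewrite (sum_height_quo (fun e =>
  \sum_(3 <= e' < m + 3) N e e' + \sum_(2 <= e' < m + 1) N e e')%N).
by rewrite !big_split /= !addnA.
Qed.
End PairCount.

(** This and the next four lemmas treat the relative positions of [a + z, b + z) and [c, d):
    disjoint, nested either way, or shifted to one side. Each removes the minimum and maximum. *)
Lemma overlap0 a b c d z : (d%:Z <= a%:Z + z) || (b%:Z + z <= c%:Z) ->
  overlap a b c d z = 0%N.
Proof. by have := overlapE a b c d z; lia. Qed.

Lemma overlap_inl a b c d z : [&& (a <= b)%N, c%:Z <= a%:Z + z & b%:Z + z <= d%:Z] ->
  overlap a b c d z = (b - a)%N.
Proof. by have := overlapE a b c d z; lia. Qed.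

Lemma overlap_inr a b c d z : [&& (c <= d)%N, a%:Z + z <= c%:Z & d%:Z <= b%:Z + z] ->
  overlap a b c d z = (d - c)%N.
Proof. by have := overlapE a b c d z; lia. Qed.

Lemma overlap_l a b c d z :
  [&& a%:Z + z <= c%:Z, b%:Z + z <= d%:Z & c%:Z <= b%:Z + z] ->
  (overlap a b c d z)%:Z = b%:Z + z - c%:Z.
Proof. by have := overlapE a b c d z; lia. Qed.

Lemma overlap_r a b c d z :
  [&& c%:Z <= a%:Z + z, d%:Z <= b%:Z + z & a%:Z + z <= d%:Z] ->
  (overlap a b c d z)%:Z = d%:Z - a%:Z - z.
Proof. by have := overlapE a b c d z; lia. Qed.

Ltac overlap_simp := repeat match goal with
  | |- context [overlap ?a ?b ?c ?d ?z] => first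
    [ rewrite (@overlap0 a b c d z); [|lia]
    | rewrite (@overlap_inl a b c d z); [|lia]
    | rewrite (@overlap_inr a b c d z); [|lia]
    | rewrite (@overlap_l a b c d z); [|lia]
    | rewrite (@overlap_r a b c d z); [|lia] ] end.

Lemma count_levi_pairsZ m (m_gt0 : (0 < m)%N) (z : int) :
  (count_mem z [seq height_diff p | p <- enum (levi_pairs (2 * m - 1))])%:Z =
    (overlap 1 (m + 2) 1 (m + 2) z)%:Z + (overlap 1 (m + 2) 0 m z)%:Z
    + (overlap 0 m 1 (m + 2) z)%:Z + (overlap 0 m 0 m z)%:Z
    + (overlap 1 (m + 2) 3 (m + 3) z)%:Z + (overlap 1 (m + 2) 2 (m + 1) z)%:Z
    + (overlap 0 m 3 (m + 3) z)%:Z + (overlap 0 m 2 (m + 1) z)%:Z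
    + (overlap 3 (m + 3) 3 (m + 3) z)%:Z + (overlap 3 (m + 3) 2 (m + 1) z)%:Z
    + (overlap 2 (m + 1) 3 (m + 3) z)%:Z + (overlap 2 (m + 1) 2 (m + 1) z)%:Z
    - (z == 0)%:Z.
Proof.
have := count_levi_pairs m_gt0 z; set c := count_mem _ _.
by move/(congr1 Posz); rewrite !PoszD => cE; rewrite -[LHS](addrK (z == 0)%:Z) cE; ring.
Qed.

(** On the two ranges between the special values all twelve overlaps are linear in [z] with a common
    slope 1 or -1, whence the factor 12. *)
Lemma count_levi_pairs_large m (z : int) (M := m%:Z) : (4 < m)%N ->
  (count_mem z [seq height_diff p | p <- enum (levi_pairs (2 * m - 1))])%:Z =
  if z == - M - 1 then 1 else if z == - M then 4 else if z == - M + 1 then 10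
  else if z == - M + 2 then 19 else if - M + 2 < z < -1 then 12 * (z + M - 2) + 18
  else if z == -1 then 12 * M - 20 else if z == 0 then 12 * M - 14
  else if z == 1 then 12 * M - 14 else if z == 2 then 12 * M - 20
  else if 2 < z < M - 1 then 12 * (M - 1 - z) + 18 else if z == M - 1 then 19
  else if z == M then 10 else if z == M + 1 then 4 else if z == M + 2 then 1 else 0.
Proof.
move=> m4; rewrite count_levi_pairsZ; last by lia.
rewrite {}/M.
do ![case: eqP => [->|?]; first by overlap_simp; lia
    | case: ifP => ?; first by overlap_simp; lia].
have : (z < - m%:Z - 1) || (m%:Z + 2 < z) by lia.
by case/orP=> ?; overlap_simp; lia.
Qed.

(** Equal counts make the two integer lists permutations of each other, which survives the map to
    [K]. The sum over [t] adds up the multiplicities of repeated values. *)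
Lemma has_spectrum_tally (K : fieldType) m (t : seq (int * nat)) (k := (2 * m - 1)%N) :
  [pchar K] =i pred0 -> (0 < m)%N ->
  (forall z : int, (count_mem z [seq height_diff p | p <- enum (levi_pairs k)])%:Z =
    \sum_(y <- t) (if y.1 == z then y.2%:Z else 0)) ->
  has_spectrum (seaweedA K (2 * k + 2) [:: (k + 2)%N; k] [:: (2 * k + 2)%N])
    [seq z%:~R | z <- tally_seq t].
Proof.
move=> ch0 m0 tE F Fh Fnd FhP z.
rewrite (seaweed_spectrum ch0 _ Fnd FhP); last by rewrite /k; lia.
have /permP/(_ (fun y => y%:~R == z)) :
    perm_eq [seq height_diff p | p <- enum (levi_pairs k)] (tally_seq t).
  apply/allP => y _ /=; rewrite count_tally_seq -eqz_nat tE.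
  rewrite -natz natr_sum; apply/eqP; apply: eq_bigr => x _.
  by rewrite natrM [x.2%:R]natz; case: ifP => _; rewrite ?mul1r ?mul0r.
move=> cE; rewrite [RHS]count_map -[RHS]cE !count_map; apply: eq_count => p /=.
by rewrite /height_diff rmorphB.
Qed.

Ltac if_lia := repeat (case: eqP => ?; try by lia);
  repeat (case: ifP => ?; try by lia); lia.

Lemma count_levi_pairs1 (z : int) :
  (count_mem z [seq height_diff p | p <- enum (levi_pairs (2 * 1 - 1))])%:Z =
  \sum_(y <- [:: (-2, 1%N); (-1, 2%N); (0, 3%N); (1, 3%N); (2, 2%N); (3, 1%N)])
     (if y.1 == z then y.2%:Z else 0).
Proof.
rewrite count_levi_pairsZ // !big_cons big_nil /=.
do 6![case: (_ =P z) => [<-|?]; first by overlap_simp; if_lia].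
have : (z < -2) || (3 < z) by lia.
by case/orP=> ?; overlap_simp; if_lia.
Qed.

Lemma count_levi_pairs3 (z : int) :
  (count_mem z [seq height_diff p | p <- enum (levi_pairs (2 * 2 - 1))])%:Z =
  \sum_(y <- [:: (-3, 1%N); (-2, 4%N); (-1, 8%N); (0, 11%N); (1, 11%N); (2, 8%N);
          (3, 4%N); (4, 1%N)])
     (if y.1 == z then y.2%:Z else 0).
Proof.
rewrite count_levi_pairsZ // !big_cons big_nil /=.
do 8![case: (_ =P z) => [<-|?]; first by overlap_simp; if_lia].
have : (z < -3) || (4 < z) by lia.
by case/orP=> ?; overlap_simp; if_lia.
Qed.

Lemma count_levi_pairs5 (z : int) :
  (count_mem z [seq height_diff p | p <- enum (levi_pairs (2 * 3 - 1))])%:Z =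
  \sum_(y <- [:: (-4, 1%N); (-3, 4%N); (-2, 10%N); (-1, 17%N); (0, 22%N); (1, 22%N);
          (2, 17%N); (3, 10%N); (4, 4%N); (5, 1%N)])
     (if y.1 == z then y.2%:Z else 0).
Proof.
rewrite count_levi_pairsZ // !big_cons big_nil /=.
do 10![case: (_ =P z) => [<-|?]; first by overlap_simp; if_lia].
have : (z < -4) || (5 < z) by lia.
by case/orP=> ?; overlap_simp; if_lia.
Qed.

Lemma count_levi_pairs7 (z : int) :
  (count_mem z [seq height_diff p | p <- enum (levi_pairs (2 * 4 - 1))])%:Z =
  \sum_(y <- [:: (-5, 1%N); (-4, 4%N); (-3, 10%N); (-2, 19%N); (-1, 28%N); (0, 34%N);
          (1, 34%N); (2, 28%N); (3, 19%N); (4, 10%N); (5, 4%N); (6, 1%N)])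
     (if y.1 == z then y.2%:Z else 0).
Proof.
rewrite count_levi_pairsZ // !big_cons big_nil /=.
do 12![case: (_ =P z) => [<-|?]; first by overlap_simp; if_lia].
have : (z < -5) || (6 < z) by lia.
by case/orP=> ?; overlap_simp; if_lia.
Qed.

(** For given [z], each indexed family contributes for at most one [i], namely [z + M - 2] or
    [M - 1 - z]; the constants agree because [k = 2 * m - 1]. *)
Lemma count_levi_pairs_tally m (z : int) (k := (2 * m - 1)%N) (M := m%:Z) : (4 < m)%N ->
  (count_mem z [seq height_diff p | p <- enum (levi_pairs k)])%:Z =
  \sum_(y <- [:: (- M - 1, 1%N); (- M, 4%N); (- M + 1, 10%N); (- M + 2, 19%N);
           (-1, (6 * k - 14)%N); (0, (6 * k - 8)%N); (1, (6 * k - 8)%N);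
           (2, (6 * k - 14)%N); (M - 1, 19%N); (M, 10%N); (M + 1, 4%N);
           (M + 2, 1%N)]
       ++ \big[cat/[::]]_(1 <= i < (m - 4).+1)
            [:: (- M + i%:Z + 2, (12 * i + 18)%N);
                (M - i%:Z - 1, (12 * i + 18)%N)]) (if y.1 == z then y.2%:Z else 0).
Proof.
move=> m4; rewrite count_levi_pairs_large // -/M big_cat big_cat_seq /=.
have -> : \sum_(1 <= i < (m - 4).+1) \sum_(y <-
      [:: (- M + i%:Z + 2, (12 * i + 18)%N); (M - i%:Z - 1, (12 * i + 18)%N)])
      (if y.1 == z then y.2%:Z else 0) =
    \sum_(1 <= i < (m - 4).+1) (if i%:Z == z + M - 2 then (12 * i + 18)%N%:Z else 0) +
    \sum_(1 <= i < (m - 4).+1)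
      (if i%:Z == M - 1 - z then (12 * i + 18)%N%:Z else 0) :> int.
  rewrite -big_split; apply: eq_bigr => i _; rewrite !big_cons big_nil /= addr0.
  have -> : (- M + i%:Z + 2 == z) = (i%:Z == z + M - 2) by lia.
  by have -> : (M - i%:Z - 1 == z) = (i%:Z == M - 1 - z) by lia.
rewrite !big_nat_pick !big_cons big_nil /=.
rewrite /k /M.
do ![case: eqP => [->|?]; first by if_lia | case: ifP => ?; first by if_lia].
by if_lia.
Qed.

Theorem mainTheorem4 (R : realType) (k m : nat)
    (hm : (0 < m)%N) (hk : k = (2 * m - 1)%N) :
  let g : {vspace 'M[R[i]]_(2 * k + 2)} :=
    seaweedA R[i] (2 * k + 2) [:: (k + 2)%N; k] [:: (2 * k + 2)%N] in
  let has_int_spectrum (t : seq (int * nat)) :=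
    has_spectrum g [seq z%:~R | z <- tally_seq t] in
  let M : int := m%:Z in
  frobenius g /\
  (k = 1%N ->
    has_int_spectrum
      [:: (-2, 1%N); (-1, 2%N); (0, 3%N); (1, 3%N); (2, 2%N); (3, 1%N)])
  /\ (k = 3%N ->
    has_int_spectrum
      [:: (-3, 1%N); (-2, 4%N); (-1, 8%N); (0, 11%N); (1, 11%N); (2, 8%N);
          (3, 4%N); (4, 1%N)])
  /\ (k = 5%N ->
    has_int_spectrum
      [:: (-4, 1%N); (-3, 4%N); (-2, 10%N); (-1, 17%N); (0, 22%N); (1, 22%N);
          (2, 17%N); (3, 10%N); (4, 4%N); (5, 1%N)])
  /\ (k = 7%N ->
    has_int_spectrum
      [:: (-5, 1%N); (-4, 4%N); (-3, 10%N); (-2, 19%N); (-1, 28%N); (0, 34%N);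
          (1, 34%N); (2, 28%N); (3, 19%N); (4, 10%N); (5, 4%N); (6, 1%N)])
  /\ ((7 < k)%N ->
    has_int_spectrum
      ([:: (- M - 1, 1%N); (- M, 4%N); (- M + 1, 10%N); (- M + 2, 19%N);
           (-1, (6 * k - 14)%N); (0, (6 * k - 8)%N); (1, (6 * k - 8)%N);
           (2, (6 * k - 14)%N); (M - 1, 19%N); (M, 10%N); (M + 1, 4%N);
           (M + 2, 1%N)]
       ++ \big[cat/[::]]_(1 <= i < (m - 4).+1)
            [:: (- M + i%:Z + 2, (12 * i + 18)%N);
                (M - i%:Z - 1, (12 * i + 18)%N)])).
Proof.
have ch0 : [pchar R[i]] =i pred0 := @pchar_num _.
move=> g has_int_spectrum M; split.
  by apply: seaweed_frobenius => //; rewrite hk; lia.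
rewrite /has_int_spectrum {has_int_spectrum}/g {}/M; subst k.
split; [|split; [|split; [|split]]] => km; apply: has_spectrum_tally => // z.
- have -> : m = 1%N by lia.
  exact: count_levi_pairs1.
- have -> : m = 2%N by lia.
  exact: count_levi_pairs3.
- have -> : m = 3%N by lia.
  exact: count_levi_pairs5.
- have -> : m = 4%N by lia.
  exact: count_levi_pairs7.
- by apply: count_levi_pairs_tally; lia.
Qed.
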